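(* Let $\mathcal{A},\mathcal{B}$ be $*$-algebras (both over the same base field, $\mathbb{R}$ or $\mathbb{C}$). Then there is an isomorphism of semigroups $$\operatorname{Pert}(\mathcal{A}\oplus\mathcal{B}) \cong \operatorname{Pert}(\mathcal{A}) \times \operatorname{Pert}(\mathcal{B}) \times (\mathcal{A}\otimes \mathcal{B}^{\circ}\oplus \mathcal{B}\otimes \mathcal{A}^{\circ})^{\mathrm{s.a.}},$$ where $(\mathcal{A}\otimes \mathcal{B}^{\circ}\oplus \mathcal{B}\otimes \mathcal{A}^{\circ})^{\mathrm{s.a.}}$ denotes the multiplicative semigroup of self-adjoint elements, i.e. those elements of $\mathcal{A}\otimes \mathcal{B}^{\circ}\oplus \mathcal{B}\otimes \mathcal{A}^{\circ}$ of the form $\sum_i \left(a_i \otimes b_i^{\circ} + b_i^* \otimes a_i^{*\circ}\right)$ (finite sums, $a_i\in\mathcal{A}$, $b_i\in\mathcal{B}$, the first term lying in $\mathcal{A}\otimes\mathcal{B}^\circ$ and the second in $\mathcal{B}\otimes\mathcal{A}^\circ$).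
   Context: A $*$-algebra means an associative unital $*$-algebra over a base field $k\in\{\mathbb{R},\mathbb{C}\}$ (with $*$ conjugate-linear if $k=\mathbb{C}$); $\otimes$ means $\otimes_k$. The opposite algebra $\mathcal{A}^\circ$ is the vector space $\mathcal{A}$, with elements written $a^\circ$, and product $a^\circ b^\circ=(ba)^\circ$. The perturbation semigroup $\operatorname{Pert}(\mathcal{A})$ is the set of elements of $\mathcal{A}\otimes\mathcal{A}^\circ$ of the form $\sum_j a_j\otimes b_j^\circ$ (finite sum) with $\sum_j a_jb_j=1$ (normalization) and $\sum_j a_j\otimes b_j^\circ=\sum_j b_j^*\otimes a_j^{*\circ}$ (self-adjointness); it is a unital semigroup under the multiplication of $\mathcal{A}\otimes\mathcal{A}^\circ$. The direct sum $\mathcal{A}\oplus\mathcal{B}$ has componentwise operations, and the product of semigroups has componentwise multiplication. *)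

(* Defs.v *)
From HB Require Import structures.
From mathcomp Require Import all_boot all_algebra.
From mathcomp Require Import boolp reals.
From mathcomp Require Import complex.

Set Implicit Arguments.
Unset Strict Implicit.
Unset Printing Implicit Defensive.

Import GRing.Theory.
Local Open Scope ring_scope.

Variant base_field := Reals | Complexes.

Definition scalars (R : realType) (b : base_field) : fieldType :=
  match b with Reals => R | Complexes => R[i] end.

Definition conj_scalar (R : realType) (b : base_field) :
    scalars R b -> scalars R b :=
  match b with Reals => id | Complexes => @conjc R end.

(* MathComp's [algType] requires [1 != 0], which excludes the zero algebra;
   [pzAlgType] drops this requirement.  The multiplication is a field of the
   mixin, and the [pzRingType] structure is derived from it, because Hierarchy
   Builder does not accept a second join of [pzRingType] and [lmodType]. *)
HB.mixin Record Lmodule_isPzAlgebra (k : fieldType) A of GRing.Lmodule k A := {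
  alg_one : A;
  alg_mul : A -> A -> A;
  alg_mulA : associative alg_mul;
  alg_mul1l : left_id alg_one alg_mul;
  alg_mul1r : right_id alg_one alg_mul;
  alg_mulDl : left_distributive alg_mul +%R;
  alg_mulDr : right_distributive alg_mul +%R;
  alg_scaleAl : forall (c : k) (x y : A), c *: alg_mul x y = alg_mul (c *: x) y;
  alg_scaleAr : forall (c : k) (x y : A), c *: alg_mul x y = alg_mul x (c *: y)
}.

#[short(type="pzAlgType")]
HB.structure Definition PzAlgebra (k : fieldType) :=
  {A of GRing.Lmodule k A & Lmodule_isPzAlgebra k A}.

#[non_forgetful_inheritance]
HB.instance Definition _ (k : fieldType) (A : pzAlgType k) :=
  GRing.Zmodule_isPzRing.Build (PzAlgebra.sort A)
    (@alg_mulA k A) (@alg_mul1l k A) (@alg_mul1r k A)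
    (@alg_mulDl k A) (@alg_mulDr k A).

Lemma pz_scalerAl (k : fieldType) (A : pzAlgType k) (c : k) (x y : A) :
  c *: (x * y) = (c *: x) * y.
Proof. exact: alg_scaleAl. Qed.

Lemma pz_scalerAr (k : fieldType) (A : pzAlgType k) (c : k) (x y : A) :
  c *: (x * y) = x * (c *: y).
Proof. exact: alg_scaleAr. Qed.

HB.mixin Record isStarAlgebra (k : fieldType) (cj : k -> k) A
    of PzAlgebra k A := {
  star : A -> A;
  starK : involutive star;
  starD : {morph star : x y / x + y};
  starM_subproof : forall x y : A,
    star (alg_mul x y) = alg_mul (star y) (star x);
  starZ : forall (c : k) x, star (c *: x) = cj c *: star x
}.

#[short(type="starAlgType")]
HB.structure Definition StarAlgebra (k : fieldType) (cj : k -> k) :=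
  {A of PzAlgebra k A & isStarAlgebra k cj A}.

#[non_forgetful_inheritance]
HB.instance Definition _ (k : fieldType) (cj : k -> k) (A : starAlgType cj) :=
  GRing.PzRing.copy (StarAlgebra.sort A) (PzAlgebra.sort A).

Lemma starM (k : fieldType) (cj : k -> k) (A : starAlgType cj) (x y : A) :
  star (x * y) = star y * star x.
Proof. exact: starM_subproof. Qed.

Section DirectSum.
Variable k : fieldType.

Section Algebra.
Variables A B : pzAlgType k.

Fact pair_pz_scalerAl (c : k) (x y : (A * B)%type) :
  c *: (x * y) = (c *: x) * y.
Proof. by congr (_, _); apply: pz_scalerAl. Qed.

Fact pair_pz_scalerAr (c : k) (x y : (A * B)%type) :
  c *: (x * y) = x * (c *: y).
Proof. by congr (_, _); apply: pz_scalerAr. Qed.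

HB.instance Definition _ := Lmodule_isPzAlgebra.Build k (A * B)%type
  (@mulrA (A * B)%type) (@mul1r (A * B)%type) (@mulr1 (A * B)%type)
  (@mulrDl (A * B)%type) (@mulrDr (A * B)%type)
  pair_pz_scalerAl pair_pz_scalerAr.
End Algebra.

Section Star.
Variables (cj : k -> k) (A B : starAlgType cj).

Definition pair_star (x : A * B) : A * B := (star x.1, star x.2).

Fact pair_starK : involutive pair_star.
Proof. by case=> x y; rewrite /pair_star /= !starK. Qed.

Fact pair_starD : {morph pair_star : x y / x + y}.
Proof. by move=> x y; congr (_, _); apply: starD. Qed.

Fact pair_starM x y : pair_star (x * y) = pair_star y * pair_star x.
Proof. by congr (_, _); apply: starM. Qed.

Fact pair_starZ (c : k) x : pair_star (c *: x) = cj c *: pair_star x.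
Proof. by congr (_, _); apply: starZ. Qed.

HB.instance Definition _ := isStarAlgebra.Build k cj (A * B)%type
  pair_starK pair_starD pair_starM pair_starZ.
End Star.
End DirectSum.

(* The opposite algebra is carried by MathComp's converse ring [A^c];
   [op a] below is the element a of A seen in it. *)
Section Opposite.
Variable k : fieldType.

HB.instance Definition _ (V : lmodType k) :=
  GRing.Zmodule_isLmodule.Build k V^c
    (@scalerA k V) (@scale1r k V) (@scalerDr k V) (@scalerDl k V).

Variable A : pzAlgType k.

HB.instance Definition _ := Lmodule_isPzAlgebra.Build k A^c
  (@mulrA A^c) (@mul1r A^c) (@mulr1 A^c) (@mulrDl A^c) (@mulrDr A^c)
  (fun c x y => @pz_scalerAr k A c y x) (fun c x y => @pz_scalerAl k A c y x).
End Opposite.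

Definition op (A : Type) (a : A) : A^c := a.

(* The tensor product is the free commutative monoid on the pairs (u, v), its
   elements being represented by lists, modulo the congruence generated by the
   bilinearity relations.  [tensor_lift] below is the universal property. *)
Section Tensor.
Variables (k : fieldType) (U V : lmodType k).
Implicit Types (s t : seq (U * V)) (u : U) (v : V) (c : k).

Inductive tensor_rel : seq (U * V) -> seq (U * V) -> Prop :=
| tr_refl s : tensor_rel s s
| tr_sym s t : tensor_rel s t -> tensor_rel t s
| tr_trans s t r : tensor_rel s t -> tensor_rel t r -> tensor_rel s r
| tr_cat s s' t t' :
    tensor_rel s s' -> tensor_rel t t' -> tensor_rel (s ++ t) (s' ++ t')
| tr_catC s t : tensor_rel (s ++ t) (t ++ s)
| tr_0l v : tensor_rel [:: (0, v)] [::]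
| tr_addl u u' v : tensor_rel [:: (u + u', v)] [:: (u, v); (u', v)]
| tr_addr u v v' : tensor_rel [:: (u, v + v')] [:: (u, v); (u, v')]
| tr_scale c u v : tensor_rel [:: (c *: u, v)] [:: (u, c *: v)].

Definition tensor_eqv : rel (seq (U * V)) := fun s t => `[<tensor_rel s t>].

Fact tensor_eqv_refl : reflexive tensor_eqv.
Proof. by move=> s; apply/asboolP/tr_refl. Qed.

Fact tensor_eqv_sym : symmetric tensor_eqv.
Proof. by move=> s t; apply/asboolP/asboolP; apply: tr_sym. Qed.

Fact tensor_eqv_trans : transitive tensor_eqv.
Proof.
by move=> t s r /asboolP st /asboolP tr; apply/asboolP/(tr_trans st tr).
Qed.

Canonical tensor_equiv_rel :=
  EquivRel tensor_eqv tensor_eqv_refl tensor_eqv_sym tensor_eqv_trans.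

Definition tensor := {eq_quot tensor_equiv_rel}%qT.

HB.instance Definition _ := Choice.on tensor.

Definition tensor_class s : tensor := (\pi_(tensor) s)%qT.
Definition tensor_repr (x : tensor) : seq (U * V) := repr x.

Fact tensor_reprK x : tensor_class (tensor_repr x) = x.
Proof. exact: reprK. Qed.

Fact tensor_classP s t : tensor_class s = tensor_class t <-> tensor_rel s t.
Proof.
split=> [/eqP|st]; last by apply/eqP; rewrite eqmodE; apply/asboolP.
by rewrite eqmodE => /asboolP.
Qed.

Fact tensor_repr_class s : tensor_rel (tensor_repr (tensor_class s)) s.
Proof. by apply/tensor_classP; rewrite tensor_reprK. Qed.

Definition tensor_zero : tensor := tensor_class [::].
Definition tensor_add (x y : tensor) : tensor :=
  tensor_class (tensor_repr x ++ tensor_repr y).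
Definition scale_list c s := [seq (c *: x.1, x.2) | x <- s].
Definition tensor_scale c (x : tensor) : tensor :=
  tensor_class (scale_list c (tensor_repr x)).
Definition tensor_opp (x : tensor) : tensor := tensor_scale (-1) x.

Fact tensor_class_cat s t :
  tensor_add (tensor_class s) (tensor_class t) = tensor_class (s ++ t).
Proof. by apply/tensor_classP/tr_cat; apply: tensor_repr_class. Qed.

Fact scale_list_rel c s t :
  tensor_rel s t -> tensor_rel (scale_list c s) (scale_list c t).
Proof.
elim=> {s t} [s|s t _|s t r _ st _|s s' t t' _ ss _|s t|v|u u' v|u v v'|d u v].
- exact: tr_refl.
- exact: tr_sym.
- exact: tr_trans.
- by rewrite /scale_list !map_cat => ?; apply: tr_cat.
- by rewrite /scale_list !map_cat; apply: tr_catC.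
- by rewrite /= scaler0; apply: tr_0l.
- by rewrite /= scalerDr; apply: tr_addl.
- exact: tr_addr.
- by rewrite /= scalerA mulrC -scalerA; apply: tr_scale.
Qed.

Fact tensor_class_scale c s :
  tensor_scale c (tensor_class s) = tensor_class (scale_list c s).
Proof. exact/tensor_classP/scale_list_rel/tensor_repr_class. Qed.

Fact tensor_class_ind (P : tensor -> Prop) :
  (forall s, P (tensor_class s)) -> forall x, P x.
Proof. by move=> Ps x; rewrite -[x]tensor_reprK. Qed.

Fact tensor_addA : associative tensor_add.
Proof.
elim/tensor_class_ind=> s; elim/tensor_class_ind=> t; elim/tensor_class_ind=> r.
by rewrite !tensor_class_cat catA.
Qed.

Fact tensor_addC : commutative tensor_add.
Proof.
elim/tensor_class_ind=> s; elim/tensor_class_ind=> t; rewrite !tensor_class_cat.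
exact/tensor_classP/tr_catC.
Qed.

Fact tensor_add0 : left_id tensor_zero tensor_add.
Proof. by elim/tensor_class_ind=> s; rewrite tensor_class_cat. Qed.

Fact tensor_scaleDl x :
  {morph tensor_scale^~ x : c d / c + d >-> tensor_add c d}.
Proof.
elim/tensor_class_ind: x => s c d.
rewrite !tensor_class_scale tensor_class_cat.
apply/tensor_classP; elim: s => [|[u v] s IHs] /=; first exact: tr_refl.
rewrite scalerDl -[_ :: scale_list _ _]cat1s.
apply: tr_trans (tr_cat (tr_addl _ _ _) IHs) _ => /=.
rewrite -[X in tensor_rel X]cat1s -[X in tensor_rel _ X]cat1s.
apply: tr_cat (tr_refl _) _; rewrite -[_ :: scale_list d s]cat1s catA.
rewrite -[X in tensor_rel X]cat1s catA.
exact: tr_cat (tr_catC _ _) (tr_refl _).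
Qed.

Fact tensor_scale0 x : tensor_scale 0 x = tensor_zero.
Proof.
elim/tensor_class_ind: x => s; rewrite tensor_class_scale.
apply/tensor_classP; elim: s => [|[u v] s IHs] /=; first exact: tr_refl.
by rewrite scale0r; apply: (tr_cat (tr_0l _) IHs).
Qed.

Fact tensor_scale1 : left_id 1 tensor_scale.
Proof.
elim/tensor_class_ind=> s; rewrite tensor_class_scale; congr tensor_class.
by elim: s => //= -[u v] s ->; rewrite scale1r.
Qed.

Fact tensor_addN : left_inverse tensor_zero tensor_opp tensor_add.
Proof.
move=> x; rewrite /tensor_opp -[X in tensor_add _ X]tensor_scale1.
by rewrite -tensor_scaleDl addNr tensor_scale0.
Qed.

HB.instance Definition _ := GRing.isZmodule.Build tensor
  tensor_addA tensor_addC tensor_add0 tensor_addN.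

Fact tensor_scaleA c d x :
  tensor_scale c (tensor_scale d x) = tensor_scale (c * d) x.
Proof.
elim/tensor_class_ind: x => s; rewrite !tensor_class_scale.
congr tensor_class; rewrite /scale_list -map_comp.
by apply: eq_map => -[u v]; rewrite /= scalerA.
Qed.

Fact tensor_scaleDr : right_distributive tensor_scale +%R.
Proof.
move=> c; elim/tensor_class_ind=> s; elim/tensor_class_ind=> t.
by rewrite /GRing.add /= !(tensor_class_cat, tensor_class_scale) -map_cat.
Qed.

HB.instance Definition _ := GRing.Zmodule_isLmodule.Build k tensor
  tensor_scaleA tensor_scale1 tensor_scaleDr tensor_scaleDl.

Definition pure_tensor u v : tensor := tensor_class [:: (u, v)].

Lemma pure_tensorDl v : {morph pure_tensor^~ v : u u' / u + u'}.
Proof.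
by move=> u u'; rewrite /GRing.add/= tensor_class_cat; apply/tensor_classP/tr_addl.
Qed.

Lemma pure_tensorDr u : {morph pure_tensor u : v v' / v + v'}.
Proof.
by move=> v v'; rewrite /GRing.add/= tensor_class_cat; apply/tensor_classP/tr_addr.
Qed.

Lemma pure_tensorZl c u v : pure_tensor (c *: u) v = c *: pure_tensor u v.
Proof. by rewrite /GRing.scale /= tensor_class_scale. Qed.

Lemma pure_tensorZr c u v : pure_tensor u (c *: v) = c *: pure_tensor u v.
Proof. by rewrite -pure_tensorZl; apply/esym/tensor_classP/tr_scale. Qed.

Lemma tensor_classE s : tensor_class s = \sum_(x <- s) pure_tensor x.1 x.2.
Proof.
elim: s => [|[u v] s IHs]; first by rewrite big_nil.
by rewrite big_cons -IHs /GRing.add /= tensor_class_cat.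
Qed.

Lemma tensor_sum (x : tensor) :
  exists s, x = \sum_(y <- s) pure_tensor y.1 y.2.
Proof. by exists (tensor_repr x); rewrite -tensor_classE tensor_reprK. Qed.

Lemma tensor_ind (P : tensor -> Prop) :
    P 0 -> (forall x y, P x -> P y -> P (x + y)) ->
  (forall u v, P (pure_tensor u v)) -> forall x, P x.
Proof.
move=> P0 PD Pp x; have [s ->] := tensor_sum x.
by apply: big_ind => // -[u v] _; apply: Pp.
Qed.
End Tensor.

Notation "u *t v" := (pure_tensor u v)
  (at level 40, left associativity) : ring_scope.

Section UniversalProperty.
Variables (k : fieldType) (U V W : lmodType k).

Definition bilinear_map (f : U -> V -> W) : Prop :=
  (forall v, linear (f^~ v)) /\ (forall u, linear (f u)).

Definition tensor_lift (f : U -> V -> W) (x : tensor U V) : W :=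
  \sum_(y <- tensor_repr x) f y.1 y.2.

Variables (f : U -> V -> W) (fB : bilinear_map f).

Let fDl u u' v : f (u + u') v = f u v + f u' v.
Proof. by have := fB.1 v 1 u u'; rewrite !scale1r. Qed.
Let fDr u v v' : f u (v + v') = f u v + f u v'.
Proof. by have := fB.2 u 1 v v'; rewrite !scale1r. Qed.
Let f0l v : f 0 v = 0.
Proof. by apply: (addrI (f 0 v)); rewrite -fDl !addr0. Qed.
Let f0r u : f u 0 = 0.
Proof. by apply: (addrI (f u 0)); rewrite -fDr !addr0. Qed.
Let fZl c u v : f (c *: u) v = c *: f u v.
Proof. by have := fB.1 v c u 0; rewrite f0l !addr0. Qed.
Let fZr c u v : f u (c *: v) = c *: f u v.
Proof. by have := fB.2 u c v 0; rewrite f0r !addr0. Qed.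

Fact lift_rel (s t : seq (U * V)) :
  tensor_rel s t -> \sum_(y <- s) f y.1 y.2 = \sum_(y <- t) f y.1 y.2.
Proof.
elim=> {s t} [s|s t _|s t r _ st _|s s' t t' _ ss _|s t|v|u u' v|u v v'|d u v].
- by [].
- by [].
- by rewrite st.
- by rewrite !big_cat /= ss => ->.
- by rewrite !big_cat /= addrC.
- by rewrite big_seq1 big_nil f0l.
- by rewrite big_seq1 big_cons big_seq1 fDl.
- by rewrite big_seq1 big_cons big_seq1 fDr.
- by rewrite !big_seq1 /= fZl fZr.
Qed.

Lemma tensor_lift_class s :
  tensor_lift f (tensor_class s) = \sum_(y <- s) f y.1 y.2.
Proof. exact/lift_rel/tensor_repr_class. Qed.

Lemma tensor_lift_pure u v : tensor_lift f (u *t v) = f u v.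
Proof. by rewrite tensor_lift_class big_seq1. Qed.

Lemma tensor_lift_linear : linear (tensor_lift f).
Proof.
move=> c; elim/tensor_class_ind=> s; elim/tensor_class_ind=> t.
have -> : c *: tensor_class s + tensor_class t =
    tensor_class (scale_list c s ++ t).
  by rewrite -tensor_class_cat -tensor_class_scale.
rewrite !tensor_lift_class big_cat big_map scaler_sumr.
by congr (_ + _); apply: eq_bigr => y _; rewrite fZl.
Qed.

Lemma tensor_lift_unique (g : tensor U V -> W) :
  linear g -> (forall u v, g (u *t v) = f u v) -> g =1 tensor_lift f.
Proof.
move=> gL gf x; have := tensor_lift_linear; have {x} [s ->] := tensor_sum x.
set l := tensor_lift f => lL.
have H (h : tensor U V -> W) : linear h -> h 0 = 0 /\ {morph h : x y / x + y}.
  move=> hL; have hD : {morph h : x y / x + y}.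
    by move=> x y; have := hL 1 x y; rewrite !scale1r.
  by split=> //; apply: (addrI (h 0)); rewrite -hD !addr0.
have [g0 gD] := H g gL; have [l0 lD] := H l lL.
rewrite (big_morph g gD g0) (big_morph l lD l0).
by apply: eq_bigr => y _; rewrite gf /l tensor_lift_pure.
Qed.
End UniversalProperty.

Section TensorAlgebra.
Variables (k : fieldType) (A B : pzAlgType k).
Local Notation T := (tensor A B).

Definition tensor_mulr (y : T) (a : A) (b : B) : T :=
  tensor_lift (fun c d => (a * c) *t (b * d)) y.

Definition tensor_mul (x y : T) : T := tensor_lift (tensor_mulr y) x.

Fact mulr_bilinear a b :
  bilinear_map (fun (c : A) (d : B) => (a * c) *t (b * d)).
Proof.
split=> v e x y; rewrite mulrDr -pz_scalerAr.
- by rewrite pure_tensorDl pure_tensorZl.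
- by rewrite pure_tensorDr pure_tensorZr.
Qed.

Fact tensor_mulr_bilinear y : bilinear_map (tensor_mulr y).
Proof.
have E a b : tensor_mulr y a b = \sum_(z <- tensor_repr y) (a * z.1) *t (b * z.2).
  by [].
split=> v e x x'; rewrite !E scaler_sumr -big_split; apply: eq_bigr => z _ /=.
- by rewrite mulrDl -pz_scalerAl pure_tensorDl pure_tensorZl.
- by rewrite mulrDl -pz_scalerAl pure_tensorDr pure_tensorZr.
Qed.

Lemma tensor_mul_pure a b c d :
  tensor_mul (a *t b) (c *t d) = (a * c) *t (b * d).
Proof.
rewrite /tensor_mul (tensor_lift_pure (tensor_mulr_bilinear _)).
exact: (tensor_lift_pure (mulr_bilinear _ _)).
Qed.

Fact tensor_mul_linear_l y : linear (tensor_mul^~ y).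
Proof. by move=> c x x'; apply: (tensor_lift_linear (tensor_mulr_bilinear y)). Qed.

Fact tensor_mul_linear_r x : linear (tensor_mul x).
Proof.
move=> c y y'; rewrite /tensor_mul /tensor_lift scaler_sumr -big_split.
by apply: eq_bigr => z _ /=; apply: (tensor_lift_linear (mulr_bilinear _ _)).
Qed.

Fact tensor_mulDl : left_distributive tensor_mul +%R.
Proof. by move=> x y z; have := tensor_mul_linear_l z 1 x y; rewrite !scale1r. Qed.

Fact tensor_mulDr : right_distributive tensor_mul +%R.
Proof. by move=> x y z; have := tensor_mul_linear_r x 1 y z; rewrite !scale1r. Qed.

Fact tensor_mul0 x : tensor_mul 0 x = 0.
Proof. by apply: (addrI (tensor_mul 0 x)); rewrite -tensor_mulDl !addr0. Qed.

Fact tensor_mul0r x : tensor_mul x 0 = 0.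
Proof. by apply: (addrI (tensor_mul x 0)); rewrite -tensor_mulDr !addr0. Qed.

Fact tensor_mulA : associative tensor_mul.
Proof.
elim/tensor_ind=> [|x x' IHx IHx'|a b] y z; first by rewrite !tensor_mul0.
  by rewrite !tensor_mulDl IHx IHx'.
elim/tensor_ind: y => [|y y' IHy IHy'|c d].
- by rewrite !(tensor_mul0, tensor_mul0r).
- by rewrite !(tensor_mulDl, tensor_mulDr) IHy IHy'.
elim/tensor_ind: z => [|z z' IHz IHz'|e f]; first by rewrite !tensor_mul0r.
  by rewrite !tensor_mulDr IHz IHz'.
by rewrite !tensor_mul_pure !mulrA.
Qed.

Definition tensor_one : T := (1 : A) *t (1 : B).

Fact tensor_mul1 : left_id tensor_one tensor_mul.
Proof.
elim/tensor_ind=> [|x y IHx IHy|a b]; first by rewrite tensor_mul0r.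
  by rewrite tensor_mulDr IHx IHy.
by rewrite tensor_mul_pure !mul1r.
Qed.

Fact tensor_mul1r : right_id tensor_one tensor_mul.
Proof.
elim/tensor_ind=> [|x y IHx IHy|a b]; first by rewrite tensor_mul0.
  by rewrite tensor_mulDl IHx IHy.
by rewrite tensor_mul_pure !mulr1.
Qed.

HB.instance Definition _ := GRing.Zmodule_isPzRing.Build T
  tensor_mulA tensor_mul1 tensor_mul1r tensor_mulDl tensor_mulDr.

Fact tensor_scalerAl (c : k) (x y : T) : c *: (x * y) = (c *: x) * y.
Proof.
have := tensor_mul_linear_l y c x 0.
by rewrite /= tensor_mul0 !addr0 => /esym.
Qed.

Fact tensor_scalerAr (c : k) (x y : T) : c *: (x * y) = x * (c *: y).
Proof.
have := tensor_mul_linear_r x c y 0.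
by rewrite /= tensor_mul0r !addr0 => /esym.
Qed.

HB.instance Definition _ := Lmodule_isPzAlgebra.Build k T
  (@mulrA T) (@mul1r T) (@mulr1 T) (@mulrDl T) (@mulrDr T)
  tensor_scalerAl tensor_scalerAr.

Lemma pure_tensorM (a c : A) (b d : B) : (a *t b) * (c *t d) = (a * c) *t (b * d).
Proof. exact: tensor_mul_pure. Qed.
End TensorAlgebra.

Section Perturbation.
Variables (k : fieldType) (cj : k -> k).

Lemma star1 (A : starAlgType cj) : star (1 : A) = 1.
Proof. by rewrite -[LHS]mulr1 -[X in _ * X]starK -starM mulr1 starK. Qed.

Section Pert.
Variable A : starAlgType cj.

Definition is_pert (x : tensor A A^c) : Prop :=
  exists s : seq (A * A),
    [/\ x = \sum_(y <- s) y.1 *t op y.2,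
        \sum_(y <- s) y.1 * y.2 = 1
      & \sum_(y <- s) y.1 *t op y.2 = \sum_(y <- s) star y.2 *t op (star y.1)].

Fact is_pert1 : is_pert 1.
Proof. by exists [:: (1, 1)]; rewrite !big_seq1 /= mulr1 star1. Qed.

Fact is_pertM x y : is_pert x -> is_pert y -> is_pert (x * y).
Proof.
move=> [s [-> s1 sa]] [t [-> t1 ta]].
exists [seq (p.1 * q.1, q.2 * p.2) | p <- s, q <- t].
have E (f g : A -> A -> A) :
    (\sum_(p <- s) f p.1 p.2 *t op (g p.1 p.2)) *
    (\sum_(q <- t) f q.1 q.2 *t op (g q.1 q.2)) =
    \sum_(p <- s) \sum_(q <- t)
      (f p.1 p.2 * f q.1 q.2) *t op (g q.1 q.2 * g p.1 p.2) :> tensor A A^c.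
  rewrite mulr_suml; apply: eq_bigr => p _; rewrite mulr_sumr.
  by apply: eq_bigr => q _; rewrite pure_tensorM.
rewrite !big_allpairs_dep /=; split.
- by rewrite (E (fun a _ => a) (fun _ b => b)).
- rewrite -s1; apply: eq_bigr => p _.
  transitivity (p.1 * (\sum_(q <- t) q.1 * q.2) * p.2); last by rewrite t1 mulr1.
  by rewrite mulr_sumr mulr_suml; apply: eq_bigr => q _; rewrite !mulrA.
- rewrite -(E (fun a _ => a) (fun _ b => b)) sa ta.
  rewrite (E (fun _ b => star b) (fun a _ => star a)).
  by apply: eq_bigr => p _; apply: eq_bigr => q _; rewrite !starM.
Qed.

Definition Pert := {x : tensor A A^c | `[<is_pert x>]}.

HB.instance Definition _ := SubChoice.on Pert.

Fact Pert_mul_subproof (x y : Pert) : `[<is_pert (val x * val y)>].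
Proof. exact/asboolP/(is_pertM (asboolW (valP x)) (asboolW (valP y))). Qed.

Definition Pert_mul (x y : Pert) : Pert :=
  Sub (val x * val y) (Pert_mul_subproof x y).
Definition Pert_one : Pert := Sub 1 (asboolT is_pert1).

Fact Pert_mulA : associative Pert_mul.
Proof. by move=> x y z; apply: val_inj; rewrite !SubK mulrA. Qed.

Fact Pert_mul1 : left_id Pert_one Pert_mul.
Proof. by move=> x; apply: val_inj; rewrite !SubK mul1r. Qed.

Fact Pert_mul1r : right_id Pert_one Pert_mul.
Proof. by move=> x; apply: val_inj; rewrite !SubK mulr1. Qed.

HB.instance Definition _ :=
  isMonoid.Build Pert Pert_mulA Pert_mul1 Pert_mul1r.
End Pert.

Section SelfAdjoint.
Variables A B : starAlgType cj.

(* The pair (x, y) is the element x + y of the direct sum. *)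
Definition is_cross_sa (x : (tensor A B^c * tensor B A^c)%type) : Prop :=
  exists s : seq (A * B),
    x = \sum_(y <- s) (y.1 *t op y.2, star y.2 *t op (star y.1)).

Fact is_cross_saM x y : is_cross_sa x -> is_cross_sa y -> is_cross_sa (x * y).
Proof.
move=> [s ->] [t ->]; exists [seq (p.1 * q.1, q.2 * p.2) | p <- s, q <- t].
rewrite big_allpairs_dep mulr_suml; apply: eq_bigr => p _.
rewrite mulr_sumr; apply: eq_bigr => q _; rewrite !starM.
by congr (_, _); rewrite /= pure_tensorM.
Qed.

Definition cross_sa :=
  {x : (tensor A B^c * tensor B A^c)%type | `[<is_cross_sa x>]}.

HB.instance Definition _ := SubChoice.on cross_sa.

Fact cross_sa_mul_subproof (x y : cross_sa) : `[<is_cross_sa (val x * val y)>].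
Proof. exact/asboolP/(is_cross_saM (asboolW (valP x)) (asboolW (valP y))). Qed.

Definition cross_sa_mul (x y : cross_sa) : cross_sa :=
  Sub (val x * val y) (cross_sa_mul_subproof x y).

Fact cross_sa_mulA : associative cross_sa_mul.
Proof. by move=> x y z; apply: val_inj; rewrite !SubK mulrA. Qed.

HB.instance Definition _ := isSemigroup.Build cross_sa cross_sa_mulA.
End SelfAdjoint.
End Perturbation.

Definition semigroup_isomorphic (G H : semigroupType) : Prop :=
  exists f : {multiplicative G -> H}, bijective f.

(* Main.v *)
(** The two projections and the two inclusions of the direct sum identify
    (A + B) (x) (A + B)^op with the direct sum of the four algebras
    A (x) A^op, B (x) B^op, A (x) B^op and B (x) A^op.  Writing an element of
    Pert (A + B) as the sum of (a_j, b_j) (x) (a'_j, b'_j)^op, the normalization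
    condition only involves the two diagonal components, and self-adjointness
    says that the diagonal components are self-adjoint and that the last
    component is the sum of the b'_j^* (x) a_j^*^op. *)
Require Import Defs.
From HB Require Import structures.
From mathcomp Require Import all_boot all_algebra.
From mathcomp Require Import boolp reals.

Set Implicit Arguments.
Unset Strict Implicit.
Unset Printing Implicit Defensive.

Import GRing.Theory.
Local Open Scope ring_scope.

Lemma big_pair (I : Type) (r : seq I) (U V : zmodType) (F : I -> U) (G : I -> V) :
  \sum_(i <- r) (F i, G i) = (\sum_(i <- r) F i, \sum_(i <- r) G i).
Proof. by elim/big_rec3: _ => // i u v w _ ->. Qed.

(** * Linear maps induced on tensor products with an opposite factor *)

Section TensorMap.
Variables (k : fieldType) (U V U' V' : lmodType k).
Variables (f : {linear U -> U'}) (g : {linear V -> V'}).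

(** The map [f (x) g^op], where [g] is carried over unchanged to the opposite spaces. *)
Definition tensor_map : tensor U V^c -> tensor U' V'^c :=
  tensor_lift (fun (u : U) (v : V^c) => f u *t op (g v)).

Fact tensor_map_bilinear :
  bilinear_map (fun (u : U) (v : V^c) => f u *t op (g v)).
Proof.
split=> [v|u] c x y.
- by rewrite linearP pure_tensorDl pure_tensorZl.
- have -> : op (g (c *: x + y)) = c *: op (g x) + op (g y) by exact: (linearP g).
  by rewrite pure_tensorDr pure_tensorZr.
Qed.

HB.instance Definition _ := GRing.isLinear.Build k (tensor U V^c)
  (tensor U' V'^c) *:%R tensor_map (tensor_lift_linear tensor_map_bilinear).

Lemma tensor_map0 : tensor_map 0 = 0.
Proof. exact: linear0. Qed.

Lemma tensor_mapD : {morph tensor_map : x y / x + y}.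
Proof. exact: linearD. Qed.

Lemma tensor_map_pure u v : tensor_map (u *t op v) = f u *t op (g v).
Proof. exact: (tensor_lift_pure tensor_map_bilinear). Qed.

Lemma tensor_map_sum (I : Type) (s : seq I) (F : I -> U) (G : I -> V) :
  tensor_map (\sum_(i <- s) F i *t op (G i)) =
  \sum_(i <- s) f (F i) *t op (g (G i)).
Proof.
by rewrite linear_sum /=; apply: eq_bigr => i _; rewrite tensor_map_pure.
Qed.
End TensorMap.

(** Both sides are additive in [x] and in [y], so pure tensors suffice; there the order is reversed
    in source and target alike, so [g] itself need only preserve products. *)
Lemma tensor_mapM (k : fieldType) (A B A' B' : pzAlgType k)
    (f : {linear A -> A'}) (g : {linear B -> B'}) :
    {morph f : x y / x * y} -> {morph g : x y / x * y} ->
  {morph tensor_map f g : x y / x * y}.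
Proof.
move=> fM gM x y.
elim/tensor_ind: x => [|x x' IHx IHx'|a b].
- by rewrite tensor_map0 !mul0r tensor_map0.
- by rewrite mulrDl !tensor_mapD IHx IHx' mulrDl.
elim/tensor_ind: y => [|y y' IHy IHy'|c d].
- by rewrite tensor_map0 !mulr0 tensor_map0.
- by rewrite mulrDr !tensor_mapD IHy IHy' mulrDr.
(* In the opposite algebra the product of [b] and [d] is [d * b] computed in [B]. *)
transitivity (f (a * c) *t op (g ((d : B) * (b : B)))).
  by rewrite pure_tensorM; exact: tensor_map_pure.
rewrite fM gM (tensor_map_pure f g a b) (tensor_map_pure f g c d).
by rewrite pure_tensorM.
Qed.

(** This removes the mismatched blocks: a projection after the other inclusion is zero. *)
Lemma tensor_map_comp0 (k : fieldType) (U1 U2 V1 V2 W1 W2 : lmodType k)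
    (f : {linear U1 -> V1}) (g : {linear U2 -> V2})
    (f' : {linear V1 -> W1}) (g' : {linear V2 -> W2}) (x : tensor U1 U2^c) :
  (forall u, f' (f u) = 0) \/ (forall u, g' (g u) = 0) ->
  tensor_map f' g' (tensor_map f g x) = 0.
Proof.
move=> z; elim/tensor_ind: x => [|x y IHx IHy|a b]; first by rewrite !tensor_map0.
  by rewrite !tensor_mapD /= IHx IHy addr0.
rewrite -[b]/(op (b : U2)) !tensor_map_pure; case: z => ->.
  (* Writing the zero vector as [0 *: 0] lets the scalar leave the tensor. *)
  by rewrite -[X in X *t _](scale0r 0) pure_tensorZl scale0r.
have -> : op (0 : W2) = 0 *: (0 : W2^c) by rewrite scale0r.
by rewrite pure_tensorZr scale0r.
Qed.

Lemma tensor_map_compK (k : fieldType) (U1 U2 V1 V2 : lmodType k)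
    (f : {linear U1 -> V1}) (g : {linear U2 -> V2})
    (f' : {linear V1 -> U1}) (g' : {linear V2 -> U2}) :
  cancel f f' -> cancel g g' -> cancel (tensor_map f g) (tensor_map f' g').
Proof.
move=> fK gK; elim/tensor_ind=> [|x y IHx IHy|a b]; first by rewrite !tensor_map0.
  by rewrite !tensor_mapD /= IHx IHy.
by rewrite -[b]/(op (b : U2)) !tensor_map_pure fK gK.
Qed.

(** * Inclusions of the summands and the four-block decomposition *)

Section Inclusions.
Variables (k : fieldType) (U V : lmodType k).

Definition incl1 (u : U) : U * V := (u, 0).
Definition incl2 (v : V) : U * V := (0, v).

Fact incl1_linear : linear incl1.
Proof. by move=> c x y; congr (_, _); rewrite /= scaler0 addr0. Qed.

Fact incl2_linear : linear incl2.
Proof. by move=> c x y; congr (_, _); rewrite /= scaler0 addr0. Qed.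

HB.instance Definition _ :=
  GRing.isLinear.Build k U (U * V)%type *:%R incl1 incl1_linear.
HB.instance Definition _ :=
  GRing.isLinear.Build k V (U * V)%type *:%R incl2 incl2_linear.

Lemma incl_split (x : U * V) : x = incl1 x.1 + incl2 x.2.
Proof. by case: x => u v; congr (_, _); rewrite /= ?addr0 ?add0r. Qed.
End Inclusions.

Section Splitting.
Variables (k : fieldType) (U V : lmodType k).
Local Notation W := (U * V)%type.
Local Notation p1 := (@fst U V).
Local Notation p2 := (@snd U V).
Local Notation i1 := (@incl1 k U V).
Local Notation i2 := (@incl2 k U V).

(** On a pure tensor, split both factors along the two summands and expand bilinearly. *)
Lemma tensor_pair_split (x : tensor W W^c) :
  x = tensor_map i1 i1 (tensor_map p1 p1 x) + tensor_map i2 i2 (tensor_map p2 p2 x)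
    + (tensor_map i1 i2 (tensor_map p1 p2 x) + tensor_map i2 i1 (tensor_map p2 p1 x)).
Proof.
elim/tensor_ind: x => [|x y IHx IHy|a b]; first by rewrite !tensor_map0 !addr0.
  by rewrite !tensor_mapD {1}IHx {1}IHy /= addrACA; congr (_ + _);
    exact: addrACA.
rewrite -[b]/(op (b : W)) !tensor_map_pure.
rewrite {1}(incl_split a) pure_tensorDl.
have -> : op (b : W) = op (i1 b.1) + op (i2 b.2) by exact: incl_split.
(* The expansion comes in the order 11, 12, 21, 22 and is regrouped as diagonal plus
   off-diagonal. *)
by rewrite !pure_tensorDr [X in _ + X]addrC addrACA.
Qed.
End Splitting.

(** * Splitting and joining perturbations *)

Section Isomorphism.
Variables (k : fieldType) (cj : k -> k) (A B : starAlgType cj).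
Local Notation AB := (A * B)%type.
Local Notation p1 := (@fst A B).
Local Notation p2 := (@snd A B).
Local Notation i1 := (@incl1 k A B).
Local Notation i2 := (@incl2 k A B).

Definition cross_part (x : tensor AB AB^c) : tensor A B^c * tensor B A^c :=
  (tensor_map p1 p2 x, tensor_map p2 p1 x).

(** [p1] is a unital star-homomorphism, so applying it to every entry of the list preserves both
    conditions. *)
Lemma is_pert_fst x : is_pert x -> is_pert (tensor_map p1 p1 x).
Proof.
case=> s [-> s1 sa]; exists [seq (y.1.1, y.2.1) | y <- s].
rewrite !big_map /=; split; first by rewrite tensor_map_sum.
- by move/(congr1 p1): s1; rewrite (linear_sum p1).
- by have := congr1 (tensor_map p1 p1) sa; rewrite !tensor_map_sum.
Qed.

Lemma is_pert_snd x : is_pert x -> is_pert (tensor_map p2 p2 x).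
Proof.
case=> s [-> s1 sa]; exists [seq (y.1.2, y.2.2) | y <- s].
rewrite !big_map /=; split; first by rewrite tensor_map_sum.
- by move/(congr1 p2): s1; rewrite (linear_sum p2).
- by have := congr1 (tensor_map p2 p2) sa; rewrite !tensor_map_sum.
Qed.

Lemma is_cross_sa_cross_part x : is_pert x -> is_cross_sa (cross_part x).
Proof.
case=> s [-> _ sa]; exists [seq (y.1.1, y.2.2) | y <- s].
rewrite big_map big_pair /=; congr (_, _); first by rewrite tensor_map_sum.
(* Rewriting by self-adjointness before applying [p2 (x) p1] yields the starred terms. *)
by rewrite sa tensor_map_sum.
Qed.

Definition pert_join (x : tensor A A^c) (y : tensor B B^c)
    (z : tensor A B^c * tensor B A^c) : tensor AB AB^c :=
  tensor_map i1 i1 x + tensor_map i2 i2 y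
    + (tensor_map i1 i2 z.1 + tensor_map i2 i1 z.2).

Lemma is_pert_join x y z : is_pert x -> is_pert y -> is_cross_sa z ->
  is_pert (pert_join x y z).
Proof.
case=> s [-> s1 sa] [t [-> t1 ta]] [r ->].
(* One list per block; the last is the starred flip of the third. *)
exists ([seq (i1 p.1, i1 p.2) | p <- s] ++ [seq (i2 p.1, i2 p.2) | p <- t]
  ++ ([seq (i1 p.1, i2 p.2) | p <- r]
  ++ [seq (i2 (star p.2), i1 (star p.1)) | p <- r])).
rewrite !big_cat !big_map /=.
have star0 (C : starAlgType cj) : star (0 : C) = 0.
  by apply: (addrI (star 0)); rewrite -starD !addr0.
have star_i1 (a : A) : star (i1 a) = i1 (star a) by congr (_, _); exact: star0.
have star_i2 (b : B) : star (i2 b) = i2 (star b) by congr (_, _); exact: star0.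
have i11 (a a' : A) : i1 a * i1 a' = i1 (a * a').
  by congr (_, _); rewrite /= mul0r.
have i22 (b b' : B) : i2 b * i2 b' = i2 (b * b').
  by congr (_, _); rewrite /= mul0r.
have i12 (a : A) (b : B) : i1 a * i2 b = 0.
  by congr (_, _); rewrite /= ?mul0r ?mulr0.
have i21 (b : B) (a : A) : i2 b * i1 a = 0.
  by congr (_, _); rewrite /= ?mul0r ?mulr0.
split.
- by rewrite /pert_join big_pair /= !tensor_map_sum -!addrA.
(* Off-diagonal products vanish, and the diagonal ones sum to [(1, 0) + (0, 1)]. *)
- rewrite (eq_bigr _ (fun p _ => i11 _ _)) (eq_bigr _ (fun p _ => i22 _ _)).
  rewrite [X in _ + (_ + (X + _))]big1 => [|p _]; last exact: i12.
  rewrite [X in _ + (_ + (_ + X))]big1 => [|p _]; last exact: i21.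
  rewrite -!linear_sum s1 t1 !addr0.
  by congr (_, _); rewrite /= ?addr0 ?add0r.
- have sa1 := congr1 (tensor_map i1 i1) sa.
  have ta1 := congr1 (tensor_map i2 i2) ta.
  rewrite !tensor_map_sum in sa1 ta1.
  (* The starred flip fixes each diagonal block and exchanges the two off-diagonal ones, hence the
     swap. *)
  rewrite sa1 ta1 [X in _ + (_ + X)]addrC.
  congr (_ + (_ + (_ + _))); apply: eq_bigr => p _;
    by rewrite !(star_i1, star_i2) ?starK.
Qed.

(** Only the block whose two inclusions match the two projections survives. *)
Lemma pert_joinK1 x y z : tensor_map p1 p1 (pert_join x y z) = x.
Proof.
rewrite /pert_join !tensor_mapD /=.
rewrite tensor_map_compK // !tensor_map_comp0 ?addr0 //; by [left|right].
Qed.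

Lemma pert_joinK2 x y z : tensor_map p2 p2 (pert_join x y z) = y.
Proof.
rewrite /pert_join !tensor_mapD /=.
rewrite [X in _ + X + _]tensor_map_compK // !tensor_map_comp0 ?addr0 ?add0r //;
  by [left|right].
Qed.

Lemma pert_joinK3 x y z : cross_part (pert_join x y z) = z.
Proof.
case: z => u v; rewrite /cross_part /pert_join !tensor_mapD /=; congr (_, _).
- rewrite [X in _ + (X + _)]tensor_map_compK // !tensor_map_comp0 ?addr0 ?add0r //;
  by [left|right].
- rewrite [X in _ + (_ + X)]tensor_map_compK // !tensor_map_comp0 ?addr0 ?add0r //;
  by [left|right].
Qed.

Definition pert_split (x : Pert AB) : (Pert A * Pert B * cross_sa A B)%type :=
  let xP := asboolW (valP x) in
  (Sub (tensor_map p1 p1 (val x)) (asboolT (is_pert_fst xP)),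
   Sub (tensor_map p2 p2 (val x)) (asboolT (is_pert_snd xP)),
   Sub (cross_part (val x)) (asboolT (is_cross_sa_cross_part xP))).

Definition pert_merge (x : (Pert A * Pert B * cross_sa A B)%type) : Pert AB :=
  Sub (pert_join (val x.1.1) (val x.1.2) (val x.2))
    (asboolT (is_pert_join (asboolW (valP x.1.1)) (asboolW (valP x.1.2))
                           (asboolW (valP x.2)))).

Lemma pert_splitK : cancel pert_split pert_merge.
Proof. by move=> x; apply: val_inj; rewrite /=; exact/esym/tensor_pair_split. Qed.

Lemma pert_mergeK : cancel pert_merge pert_split.
Proof.
move=> [[x y] z]; congr (_, _, _); apply: val_inj.
- exact: pert_joinK1.
- exact: pert_joinK2.
- exact: pert_joinK3.
Qed.

(** All products are inherited from the ambient tensor algebras, on which the maps induced by the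
    projections are multiplicative. *)
Fact pert_splitM : {morph pert_split : x y / (x * y)%g}.
Proof.
move=> x y; congr (_, _, _); apply: val_inj.
- exact: tensor_mapM.
- exact: tensor_mapM.
- by congr (_, _); apply: tensor_mapM.
Qed.

HB.instance Definition _ := isMultiplicative.Build (Pert AB)
  (Pert A * Pert B * cross_sa A B)%type pert_split pert_splitM.
End Isomorphism.

Theorem proposition2p6 (R : realType) (b : base_field)
    (A B : starAlgType (@conj_scalar R b)) :
  semigroup_isomorphic
    (Pert (A * B)%type)
    (Pert A * Pert B * cross_sa A B)%type.
Proof.
exists (@pert_split _ _ A B : {multiplicative _ -> _}).
exact: Bijective (@pert_splitK _ _ A B) (@pert_mergeK _ _ A B).
Qed.
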